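(* Suppose that $D$ generates a one-parameter uniformly bounded $C_0$-group $G_D$ in a Banach space $\mathbf{E}$, and that a vector $f$ belongs to $\mathbf{B}_\sigma(D)$, where $\sigma>0$. Then: (1) The trajectory $G_D(t)f$, $t\in\mathbb{R}$, has an extension to the complex plane as an $\mathbf{E}$-valued entire function $$G_D(z)f=\sum_{k=0}^\infty\frac{z^k}{k!}D^kf=e^{zD}f,\quad z\in\mathbb{C},$$ where the series converges uniformly on compact subsets of $\mathbb{C}$. (2) The extended trajectory $G_D(z)f$ has exponential type, i.e. $$\|G_D(z)f\|\le\|f\|e^{\sigma|\Im z|},\quad z\in\mathbb{C}.$$
   Context: $\mathbf{E}$ is a Banach space over the complex numbers. A one-parameter $C_0$-group on $\mathbf{E}$ with generator $D$ is a map $G_D:\mathbb{R}\to\mathcal{B}(\mathbf{E})$ (bounded operators) with $G_D(t_1+t_2)=G_D(t_1)G_D(t_2)$, $G_D(0)=I$, and $\lim_{t\to0}\|G_D(t)f-f\|=0$ for all $f\in\mathbf{E}$; it is uniformly bounded if $\sup_{t\in\mathbb{R}}\|G_D(t)\|<\infty$. For $\sigma>0$ the Bernstein subspace $\mathbf{B}_\sigma(D)$ is the set of all $f\in\bigcap_{k\in\mathbb{N}}\mathcal{D}(D^k)$ with $\|D^kf\|\le\sigma^k\|f\|$ for all $k\in\mathbb{N}$, where $\mathcal{D}(D^k)$ is the domain of $D^k$. $\Im z$ is the imaginary part of $z$.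
   Formalization: In part (2) the bound is M‖f‖e^{σ|Im z|} for every M ≥ sup_t‖G_D(t)‖; the stated bound without M fails for groups that are only uniformly bounded (rotations of C² in the max norm) and is recovered for isometric groups with M=1. *)

(* Defs.v *)
From HB Require Import structures.
From mathcomp Require Import all_boot all_order all_algebra.
From mathcomp Require Import all_classical all_reals all_analysis.
From mathcomp Require Export complex.

Set Implicit Arguments.
Unset Strict Implicit.
Unset Printing Implicit Defensive.

Import Order.TTheory GRing.Theory Num.Theory.
Import numFieldNormedType.Exports.

Local Open Scope classical_set_scope.
Local Open Scope ring_scope.
Local Open Scope complex_scope.

(* Complex Banach spaces are [completeNormedModType R[i]], so [`|x|] lives in
   [R[i]] (as a nonnegative real); real bounds are injected by [%:C].
   [R[i]^o] is [R[i]] with its topology and normed module structure. *)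

(* The operator norm of [T] is at most [M]. *)
Definition op_bound (R : realType) (E : completeNormedModType R[i])
    (T : E -> E) (M : R) : Prop :=
  forall x : E, `|T x| <= M%:C * `|x|.

Record c0_group (R : realType) (E : completeNormedModType R[i])
    (G : R -> {linear E -> E}) : Prop := {
  c0_group_bounded : forall t, exists M, op_bound (G t) M ;
  c0_group0 : forall x, G 0 x = x ;
  c0_groupD : forall t1 t2 x, G (t1 + t2) x = G t1 (G t2 x) ;
  c0_group_cvg : forall x, `|G t x - x| @[t --> (0 : R)] --> (0 : R[i]^o)
}.

(* The supremum over [t] of the operator norms of [G t] is at most [M]. *)
Definition group_bound (R : realType) (E : completeNormedModType R[i])
    (G : R -> {linear E -> E}) (M : R) : Prop :=
  forall t, op_bound (G t) M.

Definition uniformly_bounded (R : realType) (E : completeNormedModType R[i])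
    (G : R -> {linear E -> E}) : Prop :=
  exists M, group_bound G M.

(* The values of [op_fun] outside [op_dom] are irrelevant. Linearity is not
   required: it follows for every generator. *)
Record partial_operator (R : realType) (E : completeNormedModType R[i]) := {
  op_dom : set E ;
  op_fun :> E -> E
}.

Definition diff_quotient (R : realType) (E : completeNormedModType R[i])
    (G : R -> {linear E -> E}) (x : E) (t : R) : E :=
  (t^-1)%:C *: (G t x - x).

Definition generates (R : realType) (E : completeNormedModType R[i])
    (D : partial_operator E) (G : R -> {linear E -> E}) : Prop :=
  op_dom D = [set x | cvg (diff_quotient G x t @[t --> (0 : R)^'])] /\
  (forall x, op_dom D x -> diff_quotient G x t @[t --> (0 : R)^'] --> D x).

(* [pow_dom D k] is the domain of [D^k]; on it, [D^k] is [iter k D]. *)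
Fixpoint pow_dom (R : realType) (E : completeNormedModType R[i])
    (D : partial_operator E) (k : nat) : set E :=
  if k is k'.+1 then [set x | pow_dom D k' x /\ op_dom D (iter k' D x)]
  else setT.

Definition bernstein (R : realType) (E : completeNormedModType R[i])
    (D : partial_operator E) (sigma : R) : set E :=
  [set f | forall k : nat,
     pow_dom D k f /\ `|iter k D f| <= (sigma ^+ k)%:C * `|f|].

Definition exp_partial_sum (R : realType) (E : completeNormedModType R[i])
    (D : partial_operator E) (f : E) (n : nat) (z : R[i]^o) : E :=
  \sum_(0 <= k < n) (((z : R[i]) ^+ k / (k`!)%:R) *: iter k D f).

(* The sum of the exponential series of [D], that is [e^{zD} f]. *)
Definition exp_orbit (R : realType) (E : completeNormedModType R[i])
    (D : partial_operator E) (f : E) (z : R[i]^o) : E :=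
  limn (fun n => exp_partial_sum D f n z).

(* Complex differentiability at every point. *)
Definition entire (R : realType) (E : completeNormedModType R[i])
    (F : R[i]^o -> E) : Prop :=
  forall z : R[i]^o, derivable F z 1.

(* Main.v *)
Require Import Defs.
From mathcomp Require Import all_boot all_order all_algebra.
From mathcomp Require Import all_classical all_reals all_analysis.
From mathcomp Require Import ring lra.
Import Order.TTheory GRing.Theory Num.Theory.
Import numFieldNormedType.Exports.
Local Open Scope classical_set_scope.
Local Open Scope ring_scope.
Local Open Scope complex_scope.

(** For [a k = D^k f], the orbit [t |-> G t (a k)] is a bounded primitive of
    [t |-> G t (a k.+1)], so Taylor's formula with the mean value inequality
    gives [G t (a k) = sum_j t^j/j! a (k + j)] for real [t].  The bounds
    [|a k| <= sigma^k |f|] let the exponential series of [a] converge, and by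
    rearrangement its sum [S_a] satisfies
    [S_a (z + w) = sum_k w^k/k! S_(a (k + .)) z].  To first order in [w], this
    is complex differentiability; at [z = x] and [w = iy], it reads
    [S_a (x + iy) = sum_k (iy)^k/k! G x (a k)], which is at most
    [M |f| e^(sigma |y|)] in norm. *)

Set Implicit Arguments.
Unset Strict Implicit.
Unset Printing Implicit Defensive.

(** * Norms of a complex normed space as real numbers *)

Section RealNorm.
Variables (R : realType) (V : normedModType R[i]).
Implicit Types (x y : V) (z w : R[i]).

(* [`|x|] lives in [R[i]], whose order is partial; [nrm] makes [lra] usable. *)
Definition nrm x : R := complex.Re `|x|.

Lemma nrmE x : `|x| = (nrm x)%:C.
Proof. by rewrite /nrm RRe_real// normr_real. Qed.

Lemma nrm_ge0 x : 0 <= nrm x.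
Proof. by rewrite -ler0c -nrmE. Qed.

Lemma nrm0 : nrm 0 = 0.
Proof. by rewrite /nrm normr0. Qed.

Lemma nrm_eq0 x : nrm x = 0 -> x = 0.
Proof. by move=> x0; apply/normr0_eq0; rewrite nrmE x0. Qed.

Lemma nrmN x : nrm (- x) = nrm x.
Proof. by rewrite /nrm normrN. Qed.

Lemma nrmB x y : nrm (x - y) = nrm (y - x).
Proof. by rewrite -nrmN opprB. Qed.

Lemma ler_nrmD x y : nrm (x + y) <= nrm x + nrm y.
Proof. by rewrite -lecR raddfD/= -!nrmE ler_normD. Qed.

Lemma ler_nrm_sum I (s : seq I) (F : I -> V) :
  nrm (\sum_(i <- s) F i) <= \sum_(i <- s) nrm (F i).
Proof.
elim/big_ind2 : _ => [|x1 x2 y1 y2 h1 h2|//]; first by rewrite nrm0.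
exact: le_trans (ler_nrmD _ _) (lerD h1 h2).
Qed.

(** A positive element of [R[i]] is real, so testing convergence with real [e] loses nothing. *)
Lemma cvg_nrmP T (F : set_system T) {FF : Filter F} (u : T -> V) (l : V) :
  u @ F --> l <->
  forall e : R, 0 < e -> \forall t \near F, nrm (l - u t) < e.
Proof.
rewrite -[_ --> _]/(u t @[t --> F] --> l).
rewrite (@cvgrPdist_lt _ _ _ F); split=> [h e e0|h e e0].
  have := h e%:C; rewrite ltcR => /(_ e0); apply: filterS => t.
  by rewrite nrmE ltcR.
have eE : e = (complex.Re e)%:C by rewrite RRe_real// gtr0_real.
move: e0; rewrite eE ltcR => /h; apply: filterS => t.
by rewrite nrmE ltcR.
Qed.

End RealNorm.

(** * The modulus of a complex number as a real number *)

Section ComplexModulus.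
Variable R : realType.
Implicit Types z w : R[i].

Definition cnrm z : R := @nrm R R[i]^o z.

Lemma cnrmE z : `|z| = (cnrm z)%:C.
Proof. exact: (@nrmE R R[i]^o). Qed.

Lemma nrmZ (V : normedModType R[i]) z (x : V) : nrm (z *: x) = cnrm z * nrm x.
Proof.
by apply: complexI; rewrite rmorphM/= -cnrmE -!nrmE normrZ.
Qed.

Lemma cnrm_ge0 z : 0 <= cnrm z.
Proof. exact: nrm_ge0. Qed.

Lemma cnrmM z w : cnrm (z * w) = cnrm z * cnrm w.
Proof. by apply: complexI; rewrite rmorphM/= -!cnrmE normrM. Qed.

Lemma cnrmX z n : cnrm (z ^+ n) = cnrm z ^+ n.
Proof. by apply: complexI; rewrite rmorphXn/= -!cnrmE normrX. Qed.

Lemma cnrm_real (t : R) : cnrm t%:C = `|t|.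
Proof.
by apply: complexI; rewrite -cnrmE normc_def/= expr0n/= addr0 sqrtr_sqr.
Qed.

Lemma cnrm_iM (t : R) : cnrm ('i%C * t%:C) = `|t|.
Proof.
apply: complexI; rewrite -cnrmE normc_def /=.
rewrite !(mul0r, mul1r, mulr0, addr0, subr0, add0r, sub0r).
by rewrite oppr0 expr0n add0r sqrtr_sqr.
Qed.

Lemma cnrmV z : cnrm z^-1 = (cnrm z)^-1.
Proof. by apply: complexI; rewrite fmorphV/= -!cnrmE normfV. Qed.

Lemma cnrm_nat n : cnrm n%:R = n%:R.
Proof. by rewrite -(rmorph_nat (real_complex R)) cnrm_real normr_nat. Qed.

Lemma cnrm_continuous : continuous (cnrm : R[i]^o -> R).
Proof.
move=> z; apply/(@cvgrPdist_lt _ _ _ _ (nbhs_filter (z : R[i]^o))) => e e0.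
have := (@cvg_nrmP R R[i]^o _ _ (nbhs_filter (z : R[i]^o)) id z).1 cvg_id e e0.
apply: filterS => w; apply: le_lt_trans.
have h1 := @ler_nrmD R R[i]^o (z - w) w; rewrite subrK in h1.
have h2 := @ler_nrmD R R[i]^o (w - z) z; rewrite subrK in h2.
have h3 := @nrmB R R[i]^o z w.
by rewrite ler_norml /cnrm; lra.
Qed.

Lemma compact_cnrm_bounded (K : set R[i]^o) : compact K ->
  exists2 B : R, 0 <= B & forall z, K z -> cnrm z <= B.
Proof.
move=> cK.
have /compact_bounded [M [_ MK]] : compact ((cnrm : R[i]^o -> R) @` K).
  apply: continuous_compact => //.
  exact/continuous_subspaceT/cnrm_continuous.
(* Every number strictly above [M] is a bound, and [M] itself may be negative; this choice is above
   [M] and nonnegative. *)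
exists (`|M| + 1); first by rewrite addr_ge0.
move=> z Kz; have := MK (`|M| + 1).
rewrite (le_lt_trans (ler_norm _)) ?ltrDl// => /(_ isT (cnrm z)) /=.
by rewrite ger0_norm ?cnrm_ge0//; apply; exists z.
Qed.

End ComplexModulus.

(** * Rearrangement of finite exponential sums *)

(** Passing from [N] to [N.+1] adds the diagonal [k + j = N] to the triangle; by the binomial
    theorem that diagonal sums to the term of index [N] on the left. The field is general so that
    the identity also serves for the real majorants. *)
Lemma exp_sum_triangle (K : numFieldType) (V : lmodType K) (a : nat -> V)
    (z w : K) (N : nat) :
  \sum_(0 <= n < N) ((z + w) ^+ n / n`!%:R) *: a n =
  \sum_(0 <= k < N) (w ^+ k / k`!%:R) *:
    \sum_(0 <= j < N - k) (z ^+ j / j`!%:R) *: a (k + j)%N.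
Proof.
elim: N => [|N IHN]; first by rewrite !big_geq.
have -> : \sum_(0 <= k < N.+1) (w ^+ k / k`!%:R) *:
    (\sum_(0 <= j < N.+1 - k) (z ^+ j / j`!%:R) *: a (k + j)%N) =
  \sum_(0 <= k < N.+1) ((w ^+ k / k`!%:R) *:
    (\sum_(0 <= j < N - k) (z ^+ j / j`!%:R) *: a (k + j)%N) +
    ((w ^+ k / k`!%:R) * (z ^+ (N - k) / (N - k)`!%:R)) *: a N).
  apply: eq_big_nat => k /andP[_]; rewrite ltnS => kN.
  by rewrite subSn// big_nat_recr//= scalerDr scalerA subnKC.
rewrite big_split/= [X in _ = X + _]big_nat_recr//= subnn.
rewrite [X in _ = _ + _ *: X + _]big_geq// scaler0 addr0 -IHN.
rewrite big_nat_recr//= -scaler_suml; congr (_ + _ *: _).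
rewrite exprDn big_mkord mulr_suml; apply: eq_bigr => k _.
have kN : (k <= N)%N by rewrite -ltnS.
have f0 m : m`!%:R != 0 :> K by rewrite pnatr_eq0 -lt0n fact_gt0.
rewrite -(bin_fact kN) !natrM -[_ *+ _]mulr_natr.
have := f0 (val k); have := f0 (N - k)%N.
have b0 : ('C(N, k)%:R != 0 :> K) by rewrite pnatr_eq0 -lt0n bin_gt0.
by move=> h1 h2; field; apply/and3P.
Qed.

(** * Tails of the real exponential series *)

Section ExpTail.
Variable R : realType.

Definition exp_tail (r : R) (n : nat) : R := expR r - series (exp_coeff r) n.

Lemma exp_tail_cvg0 r : exp_tail r @ \oo --> 0.
Proof.
rewrite -(subrr (expR r)); apply: cvgB; first exact: cvg_cst.
exact: is_cvg_series_exp_coeff.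
Qed.

Lemma ler_series_exp_tail r m n : 0 <= r ->
  series (exp_coeff r) m - series (exp_coeff r) n <= exp_tail r n.
Proof.
move=> r0; rewrite lerD2r; apply: nondecreasing_cvgn_le.
  by apply: nondecreasing_series => k _ _; exact: exp_coeff_ge0.
exact: is_cvg_series_exp_coeff.
Qed.

Lemma exp_tail0 r : exp_tail r 0 = expR r.
Proof. by rewrite /exp_tail seriesEnat/= big_geq// subr0. Qed.

Lemma exp_tail2 r : exp_tail r 2 = expR r - 1 - r.
Proof.
rewrite /exp_tail seriesEnat/= big_nat_recr// big_nat1/= /exp_coeff/=.
by rewrite expr0 expr1 !divr1 opprD addrA.
Qed.

(** The estimate avoids division, so it holds on a full neighbourhood, [y = x] included. *)
Lemma is_derive_littleo (p : R -> R) (x dp : R) : is_derive x 1 p dp ->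
  forall e, 0 < e ->
  \forall y \near x, `|p y - p x - (y - x) * dp| <= e * `|y - x|.
Proof.
case=> dpx dpE e e0.
have : h^-1 *: ((p \o shift x) (h *: 1) - p x) @[h --> 0^'] --> dp.
  by rewrite -dpE; exact: dpx.
move/cvgrPdist_lt/(_ e e0) => /nbhs_ballP[d d0 dP].
apply/nbhs_ballP; exists d => // y; rewrite -ball_normE/= distrC => yd.
have [->|yx] := eqVneq y x; first by rewrite !subrr mul0r subr0 normr0 mulr0.
have yx0 : y - x != 0 by rewrite subr_eq0.
have := dP (y - x); rewrite -ball_normE/= sub0r normrN => /(_ yd yx0).
rewrite -[_ *: 1]/(_ * 1) mulr1 subrK -[_ *: _]/(_ * _) => h.
rewrite -ler_pdivrMr ?normr_gt0// -normrV ?unitfE// -normrM.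
rewrite -normrN; apply: ltW; congr (`|_| < e) : h.
by field.
Qed.

Lemma exp_tail2_littleo e : 0 < e ->
  \forall x \near (0 : R), `|exp_tail x 2| <= e * `|x|.
Proof.
move=> e0; have := is_derive_littleo (is_derive_expR (0 : R)) e0.
by apply: filterS => x; rewrite exp_tail2 expR0 mulr1 subr0.
Qed.

End ExpTail.

(** * Exponential series with geometrically bounded coefficients *)

Section ExpSeries.
Variables (R : realType) (E : completeNormedModType R[i]).
Implicit Types (a : nat -> E) (z w : R[i]).

(** The coefficients form an arbitrary sequence, because the series is also needed for shifts of
    [D^k f] and for coefficients that are themselves sums of such series. *)
Definition esum_part a (n : nat) z : E :=
  \sum_(0 <= k < n) (z ^+ k / k`!%:R) *: a k.

Definition exp_sum a z : E := limn (fun n => esum_part a n z).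

Lemma squeeze_cvg_nrm (u : nat -> E) (l : E) (c : nat -> R) :
  (forall n, nrm (l - u n) <= c n) -> c @ \oo --> 0 -> u @ \oo --> l.
Proof.
move=> uc c0; apply/cvg_nrmP => e e0.
move/cvgrPdist_lt : c0 => /(_ e e0); apply: filterS => n.
rewrite sub0r normrN => /(le_lt_trans (ler_norm _)).
exact: le_lt_trans.
Qed.

Variable s : R.
Hypothesis s0 : 0 <= s.

Section Bounded.
Variables (A : R) (a : nat -> E).
Hypothesis aA : forall k, nrm (a k) <= A * s ^+ k.

Lemma coeff_bound_ge0 : 0 <= A.
Proof. by have := aA 0; rewrite expr0 mulr1; apply: le_trans (nrm_ge0 _). Qed.
Let A0 := coeff_bound_ge0.

(** A free majorant [r] of [cnrm z * s] lets a single tail control all [z] in a compact set. *)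
Lemma nrm_exp_term r z k : cnrm z * s <= r ->
  nrm ((z ^+ k / k`!%:R) *: a k) <= A * exp_coeff r k.
Proof.
move=> zr; rewrite nrmZ cnrmM cnrmV cnrmX cnrm_nat /exp_coeff/=.
apply: (le_trans (ler_wpM2l _ (aA k))).
  by rewrite divr_ge0 ?exprn_ge0 ?cnrm_ge0.
rewrite mulrCA ler_wpM2l// mulrAC -exprMn ler_wpM2r ?invr_ge0//.
have zs0 : 0 <= cnrm z * s by rewrite mulr_ge0 ?cnrm_ge0.
by apply: lerXn2r => //; rewrite nnegrE// (le_trans zs0).
Qed.

Lemma nrm_esum_partB r z m n : cnrm z * s <= r -> (n <= m)%N ->
  nrm (esum_part a m z - esum_part a n z) <= A * exp_tail r n.
Proof.
move=> zr nm; have r0 : 0 <= r by rewrite (le_trans _ zr)// mulr_ge0 ?cnrm_ge0.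
have := ler_series_exp_tail m n r0; rewrite !seriesEnat/=.
rewrite /esum_part (big_cat_nat (leq0n n) nm)/= addrAC subrr add0r.
rewrite (big_cat_nat (leq0n n) nm)/= addrAC subrr add0r => h.
apply: (le_trans (ler_nrm_sum _ _)).
apply: le_trans (ler_wpM2l A0 h).
by rewrite mulr_sumr; apply: ler_sum => k _; exact: nrm_exp_term.
Qed.

Lemma esum_part_cvg z : (fun n => esum_part a n z) @ \oo --> exp_sum a z.
Proof.
have zr : cnrm z * s <= cnrm z * s by [].
apply/cauchy_cvgP/cauchy_exP => e e0.
have eE : e = (complex.Re e)%:C by rewrite RRe_real// gtr0_real.
move: e0; rewrite eE ltcR => e0.
have : (fun n => A * exp_tail (cnrm z * s) n) @ \oo --> A * 0.
  by apply: cvgM; [exact: cvg_cst|exact: exp_tail_cvg0].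
rewrite mulr0 => /cvgrPdist_lt/(_ _ e0) [N _ NP].
exists (esum_part a N z); exists N => // n /= Nn.
rewrite -ball_normE/= -normrN opprB nrmE ltcR.
apply: (le_lt_trans (nrm_esum_partB zr Nn)).
have := NP N (leqnn N); rewrite sub0r normrN.
exact/le_lt_trans/ler_norm.
Qed.

Lemma nrm_exp_sum_tail r z n : cnrm z * s <= r ->
  nrm (exp_sum a z - esum_part a n z) <= A * exp_tail r n.
Proof.
move=> zr; apply/ler_addgt0Pr => e e0.
have /cvg_nrmP/(_ e e0) [N _ NP] := @esum_part_cvg z.
(* An index beyond both [N] and [n]: its partial sum is within [e] of the limit and within the tail
   bound of the [n]-th one. *)
have /= h := NP (maxn N n) (leq_maxl _ _).
have := nrm_esum_partB zr (leq_maxr N n).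
have := ler_nrmD (exp_sum a z - esum_part a (maxn N n) z)
  (esum_part a (maxn N n) z - esum_part a n z).
by rewrite addrA subrK; lra.
Qed.

Lemma nrm_exp_sum z : nrm (exp_sum a z) <= A * expR (cnrm z * s).
Proof.
have := @nrm_exp_sum_tail (cnrm z * s) z 0 (lexx _).
by rewrite exp_tail0 /esum_part big_geq// subr0.
Qed.

End Bounded.

Lemma exp_sumP a z l : esum_part a n z @[n --> \oo] --> l -> exp_sum a z = l.
Proof. exact: cvg_lim. Qed.

Variables (A : R) (a : nat -> E).
Hypothesis aA : forall k, nrm (a k) <= A * s ^+ k.

Lemma nrm_shift k j : nrm (a (k + j)%N) <= (A * s ^+ k) * s ^+ j.
Proof. by rewrite -mulrA -exprD. Qed.

Lemma nrm_exp_sum_shift z k :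
  nrm (exp_sum (fun j => a (k + j)%N) z) <= (A * expR (cnrm z * s)) * s ^+ k.
Proof. by rewrite mulrAC; apply: nrm_exp_sum; exact: nrm_shift. Qed.

Lemma exp_sumD z w :
  exp_sum a (z + w) = exp_sum (fun k => exp_sum (fun j => a (k + j)%N) z) w.
Proof.
have A0 := coeff_bound_ge0 aA.
apply/esym/exp_sumP; set X := cnrm w * s; set Y := cnrm z * s.
have X0 : 0 <= X by rewrite mulr_ge0 ?cnrm_ge0.
have Y0 : 0 <= Y by rewrite mulr_ge0 ?cnrm_ge0.
(* The two partial sums run over a square and a triangle of indices; the gap is
   majorized termwise by that of [expR Y * expR X = expR (Y + X)]. *)
have gap N : nrm (esum_part a N (z + w) -
    esum_part (fun k => exp_sum (fun j => a (k + j)%N) z) N w) <=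
    A * (expR Y * series (exp_coeff X) N - series (exp_coeff (Y + X)) N).
  rewrite nrmB /esum_part exp_sum_triangle -sumrB.
  apply: (le_trans (ler_nrm_sum _ _)).
  (* The same triangle identity, with all coefficients equal to 1, rewrites the scalar majorant. *)
  have -> : series (exp_coeff (Y + X)) N =
     \sum_(0 <= k < N) exp_coeff X k * series (exp_coeff Y) (N - k)%N.
    have := @exp_sum_triangle R R^o (fun=> 1) Y X N.
    rewrite seriesEnat/= /exp_coeff => e; apply: etrans (etrans e _).
      by apply: eq_bigr => k _; exact/esym/mulr1.
    apply: eq_bigr => k _; rewrite /= [in RHS]seriesEnat/=; congr (_ * _).
    by apply: eq_bigr => j _; exact: mulr1.
  rewrite [in X in _ <= X]seriesEnat/= mulr_sumr -sumrB mulr_sumr.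
  apply: ler_sum => k _; rewrite -scalerBr nrmZ.
  rewrite -/(esum_part (fun j => a (k + j)%N) (N - k)%N z).
  have := @nrm_exp_sum_tail _ _ (nrm_shift k) Y z (N - k)%N (lexx _).
  have wk0 : 0 <= cnrm (w ^+ k / k`!%:R) by exact: cnrm_ge0.
  move=> /(ler_wpM2l wk0); congr (_ <= _).
  rewrite /exp_tail cnrmM cnrmX cnrmV cnrm_nat /exp_coeff/= /X exprMn.
  by ring.
set d := fun N => esum_part a N (z + w) -
  esum_part (fun k => exp_sum (fun j => a (k + j)%N) z) N w.
have -> : (fun N => esum_part (fun k => exp_sum (fun j => a (k + j)%N) z) N w)
    = (fun N => esum_part a N (z + w)) \- d.
  by apply/funext => N /=; rewrite /d subKr.
rewrite -[exp_sum a _]subr0; apply: cvgB; first exact: (esum_part_cvg aA).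
apply: (@squeeze_cvg_nrm _ _ _) => [N|].
  by rewrite sub0r nrmN; exact: gap.
(* The bound on the gap tends to this value, which is zero by the functional equation of [expR]. *)
have -> : (0 : R) = A * (expR Y * expR X - expR (Y + X)).
  by rewrite expRD subrr mulr0.
apply: cvgM; first exact: cvg_cst.
apply: cvgB; last exact: is_cvg_series_exp_coeff.
by apply: cvgM; [exact: cvg_cst|exact: is_cvg_series_exp_coeff].
Qed.

(** Re-expanding around [z] gives a series in [h] with coefficients [b k]. Removing its terms of
    order 0 and 1 leaves at most [B * exp_tail (cnrm h * s) 2], which is o(|h|), so the derivative
    is [b 1]. *)
Lemma exp_sum_derivable z :
  derivable (exp_sum a : R[i]^o -> E) (z : R[i]^o) 1.
Proof.
set b := fun k => exp_sum (fun j => a (k + j)%N) z.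
have bB := nrm_exp_sum_shift z; set B := A * _ in bB.
have B0 : 0 <= B := coeff_bound_ge0 bB.
apply/cvg_ex; exists (b 1%N); apply/cvg_nrmP => e e0.
(* Chosen so that the final factor [B * s / (2 * (B * s + 1))] is below 1; the added 1 covers
   [B * s = 0]. *)
have e'0 : 0 < e / (2 * (B * s + 1)).
  by rewrite divr_gt0// mulr_gt0// ltr_wpDl// mulr_ge0.
have [d d0 dP] : exists2 d, 0 < d &
    forall x : R, `|x| < d -> `|exp_tail x 2| <= e / (2 * (B * s + 1)) * `|x|.
  have /nbhs_ballP[d d0 dP] := exp_tail2_littleo e'0; exists d => // x xd.
  by apply: dP; rewrite -ball_normE/= sub0r normrN.
(* This radius gives [cnrm h * s < d], also when [s = 0]. *)
have ds0 : 0 < d / (s + 1) by rewrite divr_gt0// ltr_wpDl.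
have := @dnbhs0_lt R[i] R[i]^o (d / (s + 1))%:C.
rewrite ltcR => /(_ ds0) near_h.
have := nbhs_dnbhs_neq (0 : R[i]^o).
apply: filterS2 near_h => h.
rewrite cnrmE ltcR => hd h0.
have H0 : 0 < cnrm h.
  rewrite lt_def cnrm_ge0 andbT.
  by apply: contra_neq h0 => /(@nrm_eq0 R R[i]^o).
have -> : h *: (1 : R[i]^o) = h by exact: mulr1.
rewrite /= [h + z]addrC exp_sumD -/b.
have -> : b 1%N - h^-1 *: (exp_sum b h - exp_sum a z) =
    - (h^-1 *: (exp_sum b h - esum_part b 2 h)).
  rewrite /esum_part big_nat_recr//= big_nat1/= expr0 expr1 !divr1 scale1r.
  rewrite -[b 0%N]/(exp_sum a z) opprD addrA [in RHS]scalerBr scalerA.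
  by rewrite mulVf// scale1r opprB.
rewrite nrmN nrmZ cnrmV ltr_pdivrMl//.
apply: le_lt_trans (nrm_exp_sum_tail bB 2 (lexx _)) _.
have hs0 : 0 <= cnrm h * s by rewrite mulr_ge0// ltW.
have hsd : cnrm h * s < d.
  move: hd; rewrite ltr_pdivlMr ?ltr_wpDl// => /(le_lt_trans _); apply.
  by rewrite ler_wpM2l ?cnrm_ge0// lerDl.
have := dP (cnrm h * s); rewrite (ger0_norm hs0) => /(_ hsd).
move=> /(le_trans (ler_norm _)) /(ler_wpM2l B0) /le_lt_trans; apply.
have -> : B * (e / (2 * (B * s + 1)) * (cnrm h * s)) =
    cnrm h * (e * ((B * s) / (2 * (B * s + 1)))) by ring.
rewrite ltr_pM2l// -[X in _ < X]mulr1 ltr_pM2l//.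
have Bs0 : 0 <= B * s by rewrite mulr_ge0.
by rewrite ltr_pdivrMr ?mul1r; lra.
Qed.

End ExpSeries.

(** * Mean value inequality and Taylor's formula in a real variable *)

(** Real induction: let [c] be the supremum of the points reachable from [a]. The local hypothesis
    at [c] makes [c] reachable, and then points beyond it unless [c = b]. *)
Lemma interval_chain (R : realType) (P : R -> R -> Prop) (a b : R) :
  a <= b ->
  (forall x y z, P x y -> P y z -> P x z) ->
  (forall s, a <= s <= b -> exists2 d, 0 < d &
     forall x, `|x - s| < d -> (x <= s -> P x s) /\ (s <= x -> P s x)) ->
  P a b.
Proof.
move=> ab Ptrans Ploc.
pose S := [set x | a <= x <= b /\ P a x].
have Paa : P a a.
  have [|d d0 dP] := Ploc a; first by rewrite lexx.
  by have [|+ _] := dP a; [rewrite subrr normr0|apply].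
have Sa : S a by split => //; rewrite lexx.
have Sub : ubound S b by move=> x [/andP[]].
have supS : has_sup S by split; [exists a|exists b].
set c := sup S.
have ac : a <= c by apply: ub_le_sup => //; exists b.
have cb : c <= b by apply: ge_sup => //; exists a.
have [|d d0 dP] := Ploc c; first by rewrite ac cb.
have Pac : P a c.
  have [x Sx cx] := sup_adherent d0 supS; have [_ Pax] := Sx.
  have xc : x <= c by apply: ub_le_sup => //; exists b.
  have [|Pxc _] := dP x; last exact: Ptrans Pax (Pxc xc).
  by rewrite ltr_norml; move: cx; rewrite -/c; lra.
have [bc|cltb] := leP b c.
  by have -> : b = c by apply/eqP; rewrite eq_le bc cb.
pose y := Num.min b (c + d / 2).
have cy : c < y by rewrite lt_min cltb/=; lra.
have yb : y <= b by rewrite ge_min lexx.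
have yd : y <= c + d / 2 by rewrite ge_min lexx orbT.
have [|_ Pcy] := dP y; first by rewrite ltr_norml; lra.
have /(ub_le_sup (proj2 supS)) : S y.
  by split; [lra|exact: Ptrans Pac (Pcy (ltW cy))].
by rewrite -/c leNgt cy.
Qed.

Section Taylor.
Variables (R : realType) (E : normedModType R[i]).
Implicit Types (u v : R -> E).

(** Differentiability in a real variable with values in a complex space, as a first-order estimate
    in real norms that can be added and chained directly. *)
Definition has_rderiv u v := forall s e, 0 < e ->
  \forall x \near s, nrm (u x - u s - (x - s)%:C *: v s) <= e * `|x - s|.

Lemma has_rderivB u1 v1 u2 v2 : has_rderiv u1 v1 -> has_rderiv u2 v2 ->
  has_rderiv (u1 \- u2) (v1 \- v2).
Proof.
move=> h1 h2 s e e0; have e20 : 0 < e / 2 by lra.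
move: (h1 s _ e20) (h2 s _ e20); apply: filterS2 => x /= H1 H2.
set d1 := (X in nrm X <= _) in H1; set d2 := (X in nrm X <= _) in H2.
have -> : u1 x - u2 x - (u1 s - u2 s) - (x - s)%:C *: (v1 s - v2 s) = d1 - d2.
  rewrite /d1 /d2 scalerBr !opprD !opprK [in RHS]addrACA.
  by congr (_ + _); rewrite addrACA.
by have := ler_nrmD d1 (- d2); rewrite nrmN; lra.
Qed.

Lemma has_rderiv_cst (x : E) : has_rderiv (cst x) (cst 0).
Proof.
move=> s e e0; near=> t.
by rewrite /cst scaler0 subrr subr0 nrm0 mulr_ge0// ltW.
Unshelve. all: by end_near. Qed.

Lemma has_rderiv_scale (p p' : R -> R) (x : E) :
  (forall s : R, is_derive s 1 p (p' s)) ->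
  has_rderiv (fun t => (p t)%:C *: x) (fun t => (p' t)%:C *: x).
Proof.
move=> pp' s e e0.
have e'0 : 0 < e / (nrm x + 1) by rewrite divr_gt0// ltr_wpDl// nrm_ge0.
have := is_derive_littleo (pp' s) e'0; apply: filterS => t h.
rewrite scalerA -!scalerBl -rmorphM -!rmorphB nrmZ cnrm_real.
apply: (le_trans (ler_wpM2r (nrm_ge0 x) h)).
rewrite mulrAC ler_wpM2r// mulrAC -mulrA ler_piMr// ?(ltW e0)//.
by rewrite ler_pdivrMr ?mul1r ?lerDl// ltr_wpDl// nrm_ge0.
Qed.

Lemma mean_value_le u v (p p' : R -> R) (T : R) : 0 <= T ->
  has_rderiv u v -> (forall s : R, is_derive s 1 p (p' s)) ->
  (forall s, 0 <= s -> nrm (v s) <= p' s) ->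
  nrm (u T - u 0) <= p T - p 0.
Proof.
move=> T0 uv pp' vp; apply/ler_addgt0Pr => e e0.
pose eps := e / (T + 1).
have eps0 : 0 < eps by rewrite divr_gt0// ltr_wpDl.
suff H : nrm (u T - u 0) <= p T - p 0 + eps * (T - 0).
  apply: (le_trans H); rewrite lerD2l subr0 /eps mulrAC -mulrA.
  rewrite ler_piMr// ?(ltW e0)//.
  by rewrite ler_pdivrMr ?mul1r ?lerDl// ltr_wpDl.
(* The slack [eps * (b - a)] is additive, so [P] is transitive. Locally it absorbs the two
   first-order errors, of [u] and of [p], at [eps / 2] each. *)
pose P a b := nrm (u b - u a) <= p b - p a + eps * (b - a).
apply: (@interval_chain _ P) => //; rewrite /P.
  move=> x y z hxy hyz; have := ler_nrmD (u z - u y) (u y - u x).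
  by rewrite addrA subrK; lra.
move=> s /andP[s0 _]; have e20 : 0 < eps / 2 by lra.
have /nbhs_ballP[d1 d10 H1] := uv s _ e20.
have /nbhs_ballP[d2 d20 H2] := is_derive_littleo (pp' s) e20.
exists (Num.min d1 d2); first by rewrite lt_min d10.
move=> x; rewrite lt_min => /andP[xd1 xd2].
have {}H1 := H1 x; rewrite /= -ball_normE/= distrC in H1; have {}H1 := H1 xd1.
have {}H2 := H2 x; rewrite /= -ball_normE/= distrC in H2; have {}H2 := H2 xd2.
have := ler_nrmD (u x - u s - (x - s)%:C *: v s) ((x - s)%:C *: v s).
rewrite subrK nrmZ cnrm_real.
have := ler_wpM2l (normr_ge0 (x - s)) (vp s s0).
move: H1 H2; rewrite ler_norml => H1 /andP[H2 H2'] vb Db.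
split=> xs; [rewrite nrmB|]; set D := nrm _ in Db *; set d := nrm _ in H1 Db.
  have xs' : `|x - s| = - (x - s) by rewrite ler0_norm// subr_le0.
  by rewrite xs' in H1 H2 H2' vb Db; lra.
have xs' : `|x - s| = x - s by rewrite ger0_norm// subr_ge0.
by rewrite xs' in H1 H2 H2' vb Db; lra.
Qed.

Lemma is_derive_exp_coeff k (s : R) :
  is_derive s 1 (fun t : R => exp_coeff t k.+1) (exp_coeff s k).
Proof.
have -> : (fun t : R => exp_coeff t k.+1) = k.+1`!%:R^-1 \*: ((@id R) ^+ k.+1).
  by apply/funext => t; rewrite /exp_coeff/= /GRing.scale/= exprfctE mulrC.
apply: is_derive_eq; rewrite /exp_coeff/= factS natrM /GRing.scale/= mulr1.
have f0 : k`!%:R != 0 :> R by rewrite pnatr_eq0 -lt0n fact_gt0.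
have k0 : k.+1%:R != 0 :> R by rewrite pnatr_eq0.
by rewrite invfM mulrACA mulVf// mul1r mulrC.
Qed.

(** Induction on [n]: the remainder of order [n.+1] vanishes at 0, and its derivative is the
    remainder of order [n] of the shifted sequence, so the mean value inequality integrates the
    bound once. *)
Lemma taylor_nrm (u : nat -> R -> E) (A s : R) :
  (forall k, has_rderiv (u k) (u k.+1)) ->
  (forall k t, nrm (u k t) <= A * s ^+ k) ->
  forall n t, 0 <= t ->
    nrm (u 0%N t - \sum_(0 <= k < n) (t%:C ^+ k / k`!%:R) *: u k 0)
      <= A * s ^+ n * exp_coeff t n.
Proof.
move=> + + n; elim: n u A => [|n IHn] u A du uA t t0.
  by rewrite big_geq// subr0 /exp_coeff/= expr0 divr1 mulr1.
pose r n (w : nat -> R -> E) t :=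
  w 0%N t - \sum_(0 <= k < n) (t%:C ^+ k / k`!%:R) *: w k 0.
(* Proved by peeling off the last Taylor monomial of both remainders. *)
have drr w : (forall k, has_rderiv (w k) (w k.+1)) ->
    forall n, has_rderiv (r n.+1 w) (r n (fun k => w k.+1)).
  move=> dw; elim=> [|m IHm].
    have -> : r 1%N w = w 0%N \- cst (w 0%N 0).
      by apply/funext => y; rewrite /r big_nat1 expr0 divr1 scale1r.
    have -> : r 0%N (fun k => w k.+1) = w 1%N \- cst 0.
      by apply/funext => y; rewrite /r big_geq.
    exact: has_rderivB (has_rderiv_cst _).
  have -> : r m.+2 w = r m.+1 w \-
      (fun y => (exp_coeff y m.+1)%:C *: w m.+1 0).
    apply/funext => y; rewrite /r /= big_nat_recr//= opprD addrA.
    by rewrite /exp_coeff/= rmorphM/= rmorphXn/= fmorphV/= rmorph_nat.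
  have -> : r m.+1 (fun k => w k.+1) = r m (fun k => w k.+1) \-
      (fun y => (exp_coeff y m)%:C *: w m.+1 0).
    apply/funext => y; rewrite /r /= big_nat_recr//= opprD addrA.
    by rewrite /exp_coeff/= rmorphM/= rmorphXn/= fmorphV/= rmorph_nat.
  apply: has_rderivB => //; apply: has_rderiv_scale => y.
  exact: is_derive_exp_coeff.
have r0 : r n.+1 u 0 = 0.
  rewrite /r big_nat_recl//= expr0 divr1 scale1r big1 ?addr0 ?subrr// => k _.
  by rewrite expr0n/= mul0r scale0r.
(* The derivative of this majorant is the induction hypothesis for the shifted sequence, whose
   constant is [A * s]. *)
have := @mean_value_le _ _ (fun y => A * s ^+ n.+1 * exp_coeff y n.+1)
  (fun y => A * s ^+ n.+1 * exp_coeff y n) _ t0 (drr _ du n)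
  (fun y => is_deriveZ (A * s ^+ n.+1) (is_derive_exp_coeff n y)).
have c0 : exp_coeff (0 : R) n.+1 = 0 by rewrite /exp_coeff/= expr0n mul0r.
rewrite r0 subr0 c0 mulr0 subr0; apply => y y0.
rewrite exprS mulrA; apply: IHn => // k x.
by rewrite -mulrA -exprS.
Qed.

End Taylor.

(** Time reversal carries Taylor's formula to negative times; with [c = (-1) ^+ k] the sign from the
    chain rule is that of the next index. *)
Lemma has_rderiv_reflect (R : realType) (E : normedModType R[i])
    (u v : R -> E) (c : R[i]) : cnrm c = 1 -> has_rderiv u v ->
  has_rderiv (fun t => c *: u (- t)) (fun t => (- c) *: v (- t)).
Proof.
move=> c1 uv s e e0.
have /nbhs_ballP[d d0 dP] := uv (- s) e e0.
apply/nbhs_ballP; exists d => // x; rewrite -ball_normE/= => xd.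
have := dP (- x); rewrite -ball_normE/=.
have xs : - x - - s = - (x - s) by rewrite opprB opprK addrC.
rewrite distrC xs normrN distrC => /(_ xd).
have -> : c *: u (- x) - c *: u (- s) - (x - s)%:C *: (- c *: v (- s)) =
    c *: (u (- x) - u (- s) - (- (x - s))%:C *: v (- s)).
  by rewrite !scalerBr !scalerA rmorphN/= mulrN mulrN mulrC.
by rewrite nrmZ c1 mul1r distrC.
Qed.

(** * Orbits of the group and their exponential series *)

Section GroupOrbit.
Variables (R : realType) (E : completeNormedModType R[i]).
Variables (D : partial_operator E) (G : R -> {linear E -> E}).
Hypotheses (hG : c0_group G) (hD : generates D G).

Lemma nrm_op_bound (T : E -> E) (M : R) x : op_bound T M ->
  nrm (T x) <= M * nrm x.
Proof. by move=> /(_ x); rewrite !nrmE -rmorphM lecR. Qed.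

(** With [h = t - s], the group law gives [G t x - G s x = G s (G h x - x)], so boundedness of [G s]
    carries the derivative at 0 over to [s]. *)
Lemma has_rderiv_orbit x : op_dom D x ->
  has_rderiv (fun t => G t x) (fun t => G t (D x)).
Proof.
move=> Dx s e e0.
have [M GM] := c0_group_bounded hG s.
(* [op_bound] allows [M] to be zero or negative; a positive constant is needed as divisor. *)
have M0 : 0 < `|M| + 1 by rewrite ltr_wpDl.
have e'0 : 0 < e / (`|M| + 1) by rewrite divr_gt0.
have := hD.2 _ Dx; move/cvg_nrmP => /(_ _ e'0) /nbhs_ballP[d d0 dP].
apply/nbhs_ballP; exists d => // t; rewrite -ball_normE/= distrC => td.
have [->|ts] := eqVneq t s.
  by rewrite !subrr scale0r subr0 nrm0 normr0 mulr0.
have ts0 : t - s != 0 by rewrite subr_eq0.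
have := dP (t - s); rewrite -ball_normE/= sub0r normrN => /(_ td ts0).
rewrite /diff_quotient; set h := t - s => hd.
have -> : G t x - G s x - h%:C *: G s (D x) = G s (G h x - x - h%:C *: D x).
  rewrite (linearB (G s)) (linearB (G s)) [in RHS]linearZ/= -(c0_groupD hG) /h.
  by rewrite [s + _]addrC subrK.
apply: (le_trans (nrm_op_bound _ GM)).
have -> : G h x - x - h%:C *: D x =
    - (h%:C *: (D x - (h^-1)%:C *: (G h x - x))).
  by rewrite [in RHS]scalerBr scalerA -rmorphM divff// scale1r opprB.
rewrite nrmN nrmZ cnrm_real.
have := ler_wpM2l (ltW M0) (ler_wpM2l (normr_ge0 h) (ltW hd)).
have -> : (`|M| + 1) * (`|h| * (e / (`|M| + 1))) = e * `|h|.
  by field; rewrite gt_eqF.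
apply: le_trans; rewrite ler_wpM2r ?mulr_ge0 ?nrm_ge0//.
by rewrite (le_trans (ler_norm _))// lerDl.
Qed.

(* A negative [M] bounds [G] only when [E] is trivial. *)
Lemma group_bound_normM M (x : E) : group_bound G M -> `|M| * nrm x = M * nrm x.
Proof.
move=> GM; have [M0|M0] := leP 0 M; first by rewrite ger0_norm.
have := nrm_op_bound x (GM 0); rewrite (c0_group0 hG) => xM.
suff -> : nrm x = 0 by rewrite !mulr0.
apply/eqP; rewrite eq_le nrm_ge0 andbT (le_trans xM)//.
by rewrite mulr_le0_ge0 ?nrm_ge0// ltW.
Qed.

Lemma group_bound_norm M : group_bound G M -> group_bound G `|M|.
Proof.
move=> GM t x; rewrite !nrmE -rmorphM lecR (group_bound_normM _ GM).
exact: nrm_op_bound (GM t).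
Qed.

Section PowerSequence.
Variables (a : nat -> E) (A M s : R).
Hypotheses (M0 : 0 <= M) (GM : group_bound G M).
Hypotheses (aD : forall k, op_dom D (a k)) (aS : forall k, D (a k) = a k.+1).
Hypothesis aA : forall k, nrm (a k) <= A * s ^+ k.

Lemma nrm_group_seq k t : nrm (G t (a k)) <= M * A * s ^+ k.
Proof.
by apply: (le_trans (nrm_op_bound _ (GM t))); rewrite -mulrA ler_wpM2l.
Qed.

(** The Taylor remainder is at most [M * A * (s * |t|)^n / n!], which tends to 0. *)
Lemma exp_sum_group t : exp_sum a t%:C = G t (a 0).
Proof.
apply: exp_sumP.
pose c y n := M * A * s ^+ n * exp_coeff (y : R) n.
have c0 y : c y @ \oo --> 0.
  have -> : c y = fun n => M * A * exp_coeff (s * y) n.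
    by apply/funext => n; rewrite /c /exp_coeff/= exprMn; ring.
  rewrite -(mulr0 (M * A)); apply: cvgM; first exact: cvg_cst.
  exact: cvg_exp_coeff.
have dG k : has_rderiv (fun t => G t (a k)) (fun t => G t (a k.+1)).
  by rewrite -aS; exact: has_rderiv_orbit.
have [t0|/ltW t0] := leP 0 t.
  apply: (squeeze_cvg_nrm _ (c0 t)) => n.
  have := taylor_nrm dG nrm_group_seq n t0.
  rewrite /esum_part; under eq_bigr do rewrite (c0_group0 hG).
  exact.
apply: (squeeze_cvg_nrm _ (c0 (- t))) => n.
(* The reversed orbits again form a chain of derivatives; at time [- t] the signs cancel, as
   [(-1)^k (-t)^k = t^k]. *)
pose u k y := (-1) ^+ k *: G (- y) (a k).
have cN k : cnrm ((-1 : R[i]) ^+ k) = 1.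
  by rewrite cnrmX -(rmorphN1 (real_complex R)) cnrm_real normrN1 expr1n.
have du k : has_rderiv (u k) (u k.+1).
  have := has_rderiv_reflect (cN k) (dG k).
  by rewrite (_ : - (-1) ^+ k = (-1) ^+ k.+1)// exprS mulN1r.
have uB k y : nrm (u k y) <= M * A * s ^+ k.
  by rewrite nrmZ cN mul1r nrm_group_seq.
have t0' : 0 <= - t by rewrite oppr_ge0.
have := taylor_nrm du uB n t0'; rewrite /u expr0 scale1r opprK.
congr (nrm (_ - _) <= _); apply: eq_bigr => k _.
rewrite oppr0 (c0_group0 hG) scalerA rmorphN/= mulrAC -exprMn.
by rewrite mulrN1 opprK.
Qed.

End PowerSequence.

Lemma nrm_exp_sum_group (a : nat -> E) (A M s : R) (z : R[i]) :
  0 <= s -> 0 <= M -> group_bound G M ->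
  (forall k, op_dom D (a k)) -> (forall k, D (a k) = a k.+1) ->
  (forall k, nrm (a k) <= A * s ^+ k) ->
  nrm (exp_sum a z) <= M * A * expR (s * `|complex.Im z|).
Proof.
move=> s0 M0 GM aD aS aA.
rewrite [z in exp_sum a z]complexE (exp_sumD s0 aA) [s * _]mulrC -cnrm_iM.
apply: nrm_exp_sum => // k.
(* The [k]-th shift of [a] is again a sequence of powers of [D], started at [a k], so its sum at the
   real point is a group orbit, bounded through [M]. *)
rewrite (exp_sum_group M0 GM _ _ (nrm_shift aA k))//.
  by rewrite addn0; exact: nrm_group_seq.
by move=> j; rewrite aS addnS.
Qed.

End GroupOrbit.

(** * Uniform convergence on compact sets, and assembly of the four conclusions *)

Lemma exp_sum_uniform_cvg (R : realType) (E : completeNormedModType R[i])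
    (a : nat -> E) (A s : R) (K : set R[i]^o) : 0 <= s ->
  (forall k, nrm (a k) <= A * s ^+ k) -> compact K ->
  {uniform K, (esum_part a : nat -> R[i]^o -> E) @ \oo -->
    (exp_sum a : R[i]^o -> E)}.
Proof.
move=> s0 aA /compact_cnrm_bounded[B B0 KB] P /uniform_nbhs[U [entU UP]].
move: entU; rewrite -entourage_ballE => -[e e0 eU].
have eE : e = (complex.Re e)%:C by rewrite RRe_real// gtr0_real.
move: e0 eU; rewrite eE /= ltcR => e0 eU.
have : (fun n => A * exp_tail (B * s) n) @ \oo --> A * 0.
  by apply: cvgM; [exact: cvg_cst|exact: exp_tail_cvg0].
rewrite mulr0 => /cvgrPdist_lt/(_ _ e0); apply: filterS => n.
rewrite sub0r normrN => /(le_lt_trans (ler_norm _)) he.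
apply: UP => z Kz; apply: eU; rewrite -ball_normE/= nrmE ltcR.
apply: le_lt_trans he; apply: (nrm_exp_sum_tail s0 aA).
by rewrite ler_wpM2r// KB.
Qed.

Unset Implicit Arguments.
Set Strict Implicit.

Theorem theorem2p2 (R : realType) (E : completeNormedModType R[i])
    (D : partial_operator E) (G : R -> {linear E -> E})
    (hG : c0_group G) (hbG : uniformly_bounded G) (hD : generates D G)
    (sigma : R) (hsigma : 0 < sigma) (f : E) (hf : bernstein D sigma f) :
  [/\ (forall t : R, exp_orbit D f (t%:C) = G t f),
      entire (exp_orbit D f),
      (forall K : set R[i]^o, compact K ->
         {uniform K, exp_partial_sum D f @ \oo --> exp_orbit D f}) &
      (forall M : R, group_bound G M -> forall z : R[i]^o,
         `|exp_orbit D f z|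
           <= M%:C * `|f| * (expR (sigma * `|complex.Im z|))%:C)].
Proof.
have s0 := ltW hsigma.
pose a k := iter k D f.
(* Membership of [f] in the domain of [D^(k+1)] includes that [D^k f] lies in the domain of [D]. *)
have aD k : op_dom D (a k) by have [[]] := hf k.+1.
have aS k : D (a k) = a k.+1 by [].
have aA k : nrm (a k) <= nrm f * sigma ^+ k.
  by have [_] := hf k; rewrite !nrmE -rmorphM lecR mulrC.
split=> [t|z|K cK|M GM z].
- have [M GM] := hbG.
  have GM' := group_bound_norm hG GM.
  exact: (exp_sum_group hG hD (normr_ge0 M) GM' aD aS aA t).
- exact: (exp_sum_derivable s0 aA).
- exact: (exp_sum_uniform_cvg s0 aA cK).
- rewrite !nrmE -!rmorphM lecR.
  (* Replaces [M] by its absolute value without changing the bound, since the estimate is proved for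
     nonnegative constants. *)
  rewrite -(group_bound_normM hG f GM).
  have GM' := group_bound_norm hG GM.
  exact: (nrm_exp_sum_group hG hD z s0 (normr_ge0 M) GM' aD aS aA).
Qed.
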